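(* Let $n\ge 1$ and $m=\lfloor (n+1)/2\rfloor$. There exist $m$ semi-algebraic sets $T_0,T_1,\dots,T_{m-1}\subseteq\mathbb{R}^n$ (depending only on $n$) such that for every $\sigma\in\mathbb{C}^n$ the following are equivalent: (i) $\sigma$ is realizable; (ii) $\sigma$ satisfies the reality condition and there exist $k\in\{0,1,\dots,m-1\}$ and a reordering $\sigma'$ of the entries of $\sigma$ with $\sigma'\in U_k$ and $\Phi_k(\sigma')\in T_k$.
   Context: A list $\sigma=(\lambda_1,\dots,\lambda_n)\in\mathbb{C}^n$ is called realizable if there is an $n\times n$ real matrix $A$ with all entries nonnegative whose eigenvalues, counted with algebraic multiplicity, are $\lambda_1,\dots,\lambda_n$ (in some order). The list $\sigma$ satisfies the reality condition if $\sigma=\overline{\sigma}$ as multisets, i.e. the multiset $\{\lambda_1,\dots,\lambda_n\}$ is equal to $\{\overline{\lambda_1},\dots,\overline{\lambda_n}\}$. For an integer $k$ with $0\le 2k\le n$, $U_k\subset\mathbb{C}^n$ is the set of tuples whose first $n-2k$ entries are real and whose last $2k$ entries are $k$ consecutive conjugate pairs, i.e. tuples of the form $(x_1,\dots,x_{n-2k},y_1+iz_1,y_1-iz_1,\dots,y_k+iz_k,y_k-iz_k)$ with all $x_j,y_j,z_j\in\mathbb{R}$. The bijection $\Phi_k:U_k\to\mathbb{R}^n$ is defined by $$\Phi_k(x_1,\dots,x_{n-2k},y_1+iz_1,y_1-iz_1,\dots,y_k+iz_k,y_k-iz_k)=(x_1,\dots,x_{n-2k},y_1,z_1,\dots,y_k,z_k).$$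 A semi-algebraic subset of $\mathbb{R}^n$ is a set of the form $\bigcup_{i=1}^s\bigcap_{j=1}^{r_i}\{x\in\mathbb{R}^n : f_{i,j}(x) *_{i,j} 0\}$, where $f_{i,j}\in\mathbb{R}[X_1,\dots,X_n]$ and each $*_{i,j}$ is one of $>$, $\ge$, $=$. *)

(* Defs.v *)
From mathcomp Require Import all_boot all_order all_algebra.
From mathcomp Require Import classical_sets reals.
From mathcomp Require Import complex mpoly.
Set Implicit Arguments.
Unset Strict Implicit.
Unset Printing Implicit Defensive.
Import Order.TTheory GRing.Theory Num.Theory.
Local Open Scope classical_set_scope.
Local Open Scope ring_scope.
Local Open Scope complex_scope.

Section Realizability.
Variables (R : realType) (n : nat).
Implicit Type s : n.-tuple R[i].

(* [char_poly] is det(X - A), so its factorization over R[i] lists the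
   eigenvalues with their algebraic multiplicities. *)
Definition has_spectrum (A : 'M[R]_n) s : Prop :=
  char_poly (map_mx (real_complex R) A) = \prod_(z <- s) ('X - z%:P).

Definition realizable s : Prop :=
  exists A : 'M[R]_n, (forall i j, 0 <= A i j) /\ has_spectrum A s.

Definition reality_condition s : Prop := perm_eq s [seq z^* | z <- s].

End Realizability.

Section ConjugatePairs.
Variables (R : realType) (n k : nat).

Definition conj_pairs_list (x : seq R) (yz : seq (R * R)) : seq R[i] :=
  [seq r%:C | r <- x] ++ flatten [seq [:: p.1 +i* p.2; p.1 -i* p.2] | p <- yz].

(* Empty when n < 2 * k, since the two sides then differ in size. *)
Definition U : set (n.-tuple R[i]) :=
  [set s : n.-tuple R[i] |
    exists (x : (n - 2 * k).-tuple R) (yz : k.-tuple (R * R)),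
    s = conj_pairs_list x yz :> seq R[i]].

(* Total on C^n, but meaningful only on U.  In the tail, the entries at even
   offset are the y_j + i z_j and those at odd offset the y_j - i z_j, whence
   the sign in the latter case; see [PhiE]. *)
Definition Phi (s : n.-tuple R[i]) : n.-tuple R :=
  [tuple if (n - 2 * k <= j)%N && odd (j - (n - 2 * k))
         then - complex.Im (tnth s j) else complex.Re (tnth s j) | j < n].

Lemma PhiE (s : n.-tuple R[i]) (x : (n - 2 * k).-tuple R)
    (yz : k.-tuple (R * R)) :
  s = conj_pairs_list x yz :> seq R[i] ->
  Phi s = x ++ flatten [seq [:: p.1; p.2] | p <- yz] :> seq R.
Proof.
move=> sE.
have szp (T : Type) (f g : R * R -> T) (l : seq (R * R)) :
    size (flatten [seq [:: f p; g p] | p <- l]) = (size l).*2.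
  by elim: l => //= p l ->; rewrite doubleS.
have nthp (T : Type) (d : T) (f g : R * R -> T) (l : seq (R * R)) i :
    (i < (size l).*2)%N ->
    nth d (flatten [seq [:: f p; g p] | p <- l]) i =
    (if odd i then g else f) (nth (0, 0) l i./2).
  elim: l i => [|p l IH] [|[|i]] //=; rewrite doubleS !ltnS => /IH ->.
  by rewrite negbK.
have nE : n = (n - 2 * k + k.*2)%N.
  by rewrite -[LHS](size_tuple s) sE size_cat size_map szp !size_tuple.
apply: (@eq_from_nth _ 0) => [|j].
  by rewrite size_cat szp !size_tuple -nE.
rewrite size_tuple => ltjn.
rewrite -[j]/(nat_of_ord (Ordinal ltjn)) -tnth_nth tnth_mktuple /=.
rewrite (tnth_nth 0) /= sE !nth_cat size_map !size_tuple.
case: ltnP => [ltjx|lexj] /=.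
  by rewrite (nth_map 0) ?size_tuple.
have ltj : (j - (n - 2 * k) < (size yz).*2)%N.
  by rewrite size_tuple ltn_subLR // -nE.
by rewrite !nthp //; case: odd => /=; rewrite ?opprK.
Qed.

End ConjugatePairs.

Section SemiAlgebraic.
Variables (R : realType) (n : nat).

Variant sign_cond := SignGt | SignGe | SignEq.

Definition sign_holds (c : sign_cond) (r : R) : bool :=
  match c with
  | SignGt => r > 0
  | SignGe => r >= 0
  | SignEq => r == 0
  end.

(* A list of lists of conditions [f * 0], read as a finite union of finite
   intersections. *)
Definition semialgebraic (S : set (n.-tuple R)) : Prop :=
  exists F : seq (seq ({mpoly R[n]} * sign_cond)),
    S = [set x : n.-tuple R |
          has (all (fun c => sign_holds c.2 c.1.@[tnth x])) F].

End SemiAlgebraic.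

(* Main.v *)
Require Import Defs.
From mathcomp Require Import all_boot all_order all_algebra.
From mathcomp Require Import classical_sets reals.
From mathcomp Require Import complex mpoly.
From mathcomp Require Import polyrcf ordered_qelim qe_rcf.

(** Take for T_k the set of all coordinates w in R^n such that some nonnegative
    matrix has characteristic polynomial
    prod_j (X - x_j) * prod_j ((X - y_j)^2 + z_j^2), where
    w = (x_1, .., x_(n - 2k), y_1, z_1, .., y_k, z_k).  A tuple of U_k is realizable
    exactly when its image under Phi_k lies in T_k, so three facts remain.

    The set T_k is semi-algebraic: it is the projection, along the n^2 matrix
    entries, of a set given by polynomial equations (coefficients of the
    characteristic polynomial) and inequalities (signs of the entries).  By the
    Tarski-Seidenberg theorem [semialgebraic_projection], a consequence of
    quantifier elimination over real closed fields, projections preserve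
    semi-algebraic sets.

    The spectrum of a real matrix is closed under conjugation
    ([reality_of_real_poly]), so it can be reordered as its real members followed by
    conjugate pairs ([conj_pairs_list_of_reality]).

    The number k of pairs is less than m = floor ((n + 1) / 2): equivalently, there
    is at least one real eigenvalue.  For even n this rests on nonnegativity, namely
    on the existence part of the Perron-Frobenius theorem.  The proof given in
    [nonneg_perron_resolvent] is by induction on the size, through Schur
    complements: it produces a real root of the characteristic polynomial beyond
    which the resolvent of the matrix is nonnegative. *)

Set Implicit Arguments.
Unset Strict Implicit.
Unset Printing Implicit Defensive.
Import Order.TTheory GRing.Theory Num.Theory.
Local Open Scope ring_scope.

(** * A real eigenvalue of a nonnegative matrix *)

Section PolynomialSigns.
Variable R : rcfType.
Implicit Types (p : {poly R}) (a r x : R).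

Lemma monic_root_ge p a : p \is monic -> p.[a] <= 0 ->
  exists2 r, a <= r & root p r.
Proof.
move=> pmon pa.
have [|n nP] := @poly_pinfty_gt_lc _ p; first by rewrite (monicP pmon) ltr01.
have [||c] := @poly_ivtW _ p a (Num.max a n).
- by rewrite le_max lexx.
- rewrite pa /=; apply: le_trans (nP _ _); first by rewrite (monicP pmon) ler01.
  by rewrite le_max lexx orbT.
by case/andP=> ac _ rc; exists c.
Qed.

Lemma monic_largest_root p a : p \is monic -> p.[a] <= 0 ->
  exists r, [/\ a <= r, root p r & forall x, r < x -> 0 < p.[x]].
Proof.
move=> pmon pa.
have p0 : p != 0 by rewrite monic_neq0.
have [c ac rc] := monic_root_ge pmon pa.
have rootsP x : root p x = (x \in rootsR p).
  by rewrite -(roots_on_rootsR p0).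
have [r rin rmax] : exists2 r, r \in rootsR p & {in rootsR p, forall x, x <= r}.
  have : rootsR p != [::] by apply/eqP => e; move: rc; rewrite rootsP e.
  elim: (rootsR p) => // y s IH _.
  have [->|/IH[r rs rP]] := eqVneq s [::].
    by exists y; rewrite ?mem_head // => x; rewrite inE => /eqP ->.
  have [yr|ry] := leP y r.
    by exists r; rewrite ?inE ?rs ?orbT // => x; rewrite inE => /predU1P[->//|/rP].
  exists y; rewrite ?mem_head // => x; rewrite inE => /predU1P[->//|/rP xr].
  exact: le_trans xr (ltW ry).
exists r; split; first by apply: le_trans ac (rmax _ _); rewrite -rootsP.
  by rewrite rootsP.
move=> x rx; rewrite ltNge; apply/negP => /(monic_root_ge pmon)[d xd].
by rewrite rootsP => /rmax; rewrite leNgt (lt_le_trans rx xd).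
Qed.

Lemma horner_ge0_closed p r : (forall x, r < x -> 0 <= p.[x]) -> 0 <= p.[r].
Proof.
move=> pos; rewrite leNgt; apply/negP => neg.
have [|d d0 dP] := @poly_cont _ r p (- p.[r]); first by rewrite oppr_gt0.
have := dP (r + d / 2); have d2 : 0 < d / 2 by rewrite divr_gt0.
rewrite addrC addKr gtr0_norm // ltr_pdivrMr // ltr_pMr // ltr1n => /(_ isT).
have := pos (r + d / 2); rewrite ltrDl addrC => /(_ d2) px.
by rewrite ger0_norm ?subr_ge0 ?(le_trans (ltW neg)) // gtrDr ltNge px.
Qed.

End PolynomialSigns.

Section Perron.
Variable R : rcfType.

Definition nonneg_mx m n (A : 'M[R]_(m, n)) := forall i j, 0 <= A i j.

Lemma nonneg_mulmx m n p (A : 'M[R]_(m, n)) (B : 'M[R]_(n, p)) :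
  nonneg_mx A -> nonneg_mx B -> nonneg_mx (A *m B).
Proof. by move=> A0 B0 i j; rewrite mxE sumr_ge0 // => k _; rewrite mulr_ge0. Qed.

Lemma nonneg_block_mx m1 m2 n1 n2 (Aul : 'M[R]_(m1, n1)) (Aur : 'M[R]_(m1, n2))
    (Adl : 'M[R]_(m2, n1)) (Adr : 'M[R]_(m2, n2)) :
  nonneg_mx Aul -> nonneg_mx Aur -> nonneg_mx Adl -> nonneg_mx Adr ->
  nonneg_mx (block_mx Aul Aur Adl Adr).
Proof.
move=> ul ur dl dr i j; rewrite mxE.
by case: split => i'; rewrite mxE; case: split => j'.
Qed.

Lemma horner_char_poly n (A : 'M[R]_n) x : (char_poly A).[x] = \det (x%:M - A).
Proof.
rewrite /char_poly -[LHS]/(horner_eval x _) -det_map_mx; congr (\det _).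
apply/matrixP => i j; rewrite !mxE /= /horner_eval.
by rewrite !hornerE hornerMn hornerX.
Qed.

(** Multiplying by the unipotent block matrix with lower left block - N c kills
    the block c, and leaves the Schur complement a - b N c in the corner. *)
Lemma det_schur n (a : 'M[R]_1) (b : 'rV[R]_n) (c : 'cV[R]_n) (D N : 'M[R]_n) :
  D *m N = 1%:M ->
  \det (block_mx a b c D) = \det D * (a - b *m N *m c) 0 0.
Proof.
move=> DN; rewrite [RHS]mulrC -det_mx11 -(det_ublock _ b D).
rewrite -[LHS]mulr1.
have <- : \det (block_mx 1%:M 0 (- (N *m c)) 1%:M) = 1 :> R.
  by rewrite (det_lblock (1%:M : 'M_1)) !det1 mulr1.
rewrite -det_mulmx mulmx_block !mulmx1 !mulmx0 !add0r !mulmxN mulmxA.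
by rewrite mulmxA DN mul1mx subrr; congr (\det (block_mx _ _ _ _)).
Qed.

(** The off-diagonal blocks carry a sign because this serves for x - A with A
    nonnegative: the inverse then involves no subtraction, and is nonnegative as
    soon as b, c, N are and s > 0. *)
Lemma schur_inverse n (a : 'M[R]_1) (b : 'rV[R]_n) (c : 'cV[R]_n)
    (D N : 'M[R]_n) (s : R) :
  D *m N = 1%:M -> s != 0 -> (a - b *m N *m c) = s%:M ->
  block_mx a (- b) (- c) D *m
  block_mx (s^-1)%:M (s^-1 *: (b *m N)) (s^-1 *: (N *m c))
           (N + s^-1 *: (N *m c *m (b *m N))) = 1%:M.
Proof.
move=> DN s0 sE; have -> : a = s%:M + b *m N *m c by rewrite -sE subrK.
rewrite mulmx_block !mulmxDl !mulmxDr !mulNmx -!scalemxAr !mulmxA DN mul1mx.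
rewrite !mul_mx_scalar !mul_scalar_mx scale_scalar_mx mulVf //.
rewrite scalar_mx_block; congr block_mx.
- by rewrite addrK.
- by rewrite -scalemxAl scalerA mulVf // scale1r addrACA !subrr addr0.
- by rewrite addNr.
- by rewrite addrCA addNr addr0.
Qed.

(** The conclusion about the resolvent (x - A)^-1 is what makes the induction on
    the size work.  Split off the first row and column, with corner a and
    remaining block B, and let rB be the root given for B.  For x > rB the Schur
    complement formula reads
    p_A(x) = p_B(x) (x - a - b (x - B)^-1 c) <= p_B(x) (x - a),
    as the resolvent of B is nonnegative.  At the limit x = rB the right-hand
    side vanishes, so p_A(rB) <= 0 and p_A has a root in [rB, +oo[.  Beyond its
    largest root p_A and p_B are positive, hence so is the Schur complement, and
    the block formula for the inverse shows the resolvent of A nonnegative. *)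
Lemma nonneg_perron_resolvent n (A : 'M[R]_n.+1) : nonneg_mx A ->
  exists r : R, root (char_poly A) r /\ forall x : R, r < x ->
    0 < (char_poly A).[x] /\
    exists2 N, nonneg_mx N & (x%:M - A) *m N = 1%:M.
Proof.
elim: n A => [|n IH] A A0.
  have pE x : (char_poly A).[x] = x - A 0 0.
    by rewrite horner_char_poly det_mx11 !mxE.
  exists (A 0 0); split; first by rewrite rootE pE subrr.
  move=> x xA; rewrite pE subr_gt0; split => //.
  exists ((x - A 0 0)^-1)%:M.
    by move=> i j; rewrite !mxE mulrn_wge0 // invr_ge0 subr_ge0 ltW.
  rewrite mul_mx_scalar; apply/matrixP => i j; rewrite !mxE !ord1 eqxx.
  by rewrite mulVf // gt_eqF ?subr_gt0.
rewrite -[n.+2]/(1 + n.+1)%N in A A0 *.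
pose a := ulsubmx A; pose b := ursubmx A; pose c := dlsubmx A; pose B := drsubmx A.
have AE x : x%:M - A = block_mx (x%:M - a) (- b) (- c) (x%:M - B).
  rewrite -[A in LHS]submxK scalar_mx_block opp_block_mx add_block_mx.
  by rewrite !add0r.
have [b0 c0 B0] : [/\ nonneg_mx b, nonneg_mx c & nonneg_mx B].
  by split=> i j; rewrite !mxE.
have [rB [rootB BP]] := IH B B0.
have pE x N : (x%:M - B) *m N = 1%:M ->
    (char_poly A).[x] = (char_poly B).[x] * (x%:M - a - b *m N *m c) 0 0.
  move=> BN; rewrite !horner_char_poly AE (det_schur _ _ _ BN).
  by rewrite mulNmx mulmxN mulNmx opprK.
have pA_le0 : (char_poly A).[rB] <= 0.
  (* q is nonnegative on ]rB, +oo[, and q(rB) = - p_A(rB) since p_B(rB) = 0. *)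
  pose q := ('X - (a 0 0)%:P) * char_poly B - char_poly A.
  have := @horner_ge0_closed _ q rB; rewrite !hornerE (rootP rootB) mulr0 sub0r.
  rewrite oppr_ge0; apply => x rx; have [pB [N N0 BN]] := BP x rx.
  have sE : (x%:M - a - b *m N *m c) 0 0 = x - a 0 0 - (b *m N *m c) 0 0.
    rewrite [LHS]mxE [(x%:M - a) 0 0]mxE [x%:M 0 0]mxE eqxx.
    by rewrite [(- a) 0 0]mxE [(- _ : 'M_1) 0 0]mxE.
  rewrite !hornerE (pE _ _ BN) sE mulrC -mulrBr mulr_ge0 ?(ltW pB) //.
  by rewrite subKr; exact/nonneg_mulmx/c0/nonneg_mulmx.
have [r [rBr rootA rP]] := monic_largest_root (char_poly_monic A) pA_le0.
exists r; split=> // x rx; split; first exact: rP.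
have [pB [N N0 BN]] := BP x (le_lt_trans rBr rx).
pose s := (x%:M - a - b *m N *m c) 0 0.
have s0 : 0 < s by rewrite -(pmulr_rgt0 _ pB) -(pE _ _ BN) rP.
eexists; last first.
  by rewrite AE; apply: (schur_inverse BN (lt0r_neq0 s0)); exact: mx11_scalar.
have sV : 0 <= s^-1 by rewrite invr_ge0 ltW.
have scale_ge0 m1 m2 (M : 'M[R]_(m1, m2)) : nonneg_mx M -> nonneg_mx (s^-1 *: M).
  by move=> M0 i j; rewrite mxE mulr_ge0.
apply: nonneg_block_mx.
- by move=> i j; rewrite mxE mulrn_wge0.
- exact/scale_ge0/nonneg_mulmx.
- exact/scale_ge0/nonneg_mulmx.
- move=> i j; rewrite mxE addr_ge0 //.
  by apply: scale_ge0; apply: nonneg_mulmx; exact: nonneg_mulmx.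
Qed.

End Perron.

(** * Operations on semi-algebraic sets *)

Section SemialgebraicAlgebra.
Variables (R : realType) (n : nat).
Implicit Types (S : set (n.-tuple R)) (p : {mpoly R[n]}).

Lemma semialgebraic_ext S S' : (forall x, S x <-> S' x) ->
  semialgebraic S -> semialgebraic S'.
Proof.
move=> SS' [F SE]; exists F; rewrite -SE.
by apply/seteqP; split => x /SS'.
Qed.

Lemma semialgebraic_sign p c :
  semialgebraic [set x : n.-tuple R | sign_holds c p.@[tnth x]]%classic.
Proof.
exists [:: [:: (p, c)]]; apply/seteqP; split => x /=; first by move->.
by rewrite andbT orbF.
Qed.

Lemma semialgebraic_bool (b : bool) :
  semialgebraic [set x : n.-tuple R | b]%classic.
Proof. by exists (if b then [:: [::]] else [::]); case: b. Qed.

Lemma semialgebraicU S S' : semialgebraic S -> semialgebraic S' ->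
  semialgebraic (S `|` S')%classic.
Proof.
move=> [F ->] [F' ->]; exists (F ++ F'); apply/seteqP; split => x /=;
  by rewrite has_cat => /orP.
Qed.

Lemma semialgebraicI S S' : semialgebraic S -> semialgebraic S' ->
  semialgebraic (S `&` S')%classic.
Proof.
move=> [F ->] [F' ->]; exists [seq C ++ C' | C <- F, C' <- F'].
have hasI a : has (all a) [seq C ++ C' | C <- F, C' <- F'] =
    has (all a) F && has (all a) F'.
  elim: F => //= C F IH; rewrite has_cat IH andb_orl has_map; congr (_ || _).
  by elim: F' {IH} => [|C' F' /= ->]; rewrite /= ?andbF // all_cat andb_orr.
by apply/seteqP; split => x /=; rewrite hasI => /andP.
Qed.

End SemialgebraicAlgebra.

(** * The Tarski-Seidenberg theorem *)

Section Projection.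
Variable R : realType.

(** Variables with index at least n evaluate to the default value 0 of the
    environment, whence the zero polynomial for them. *)
Lemma rterm_mpoly n (t : GRing.term R) : GRing.rterm t ->
  exists p : {mpoly R[n]}, forall x : n.-tuple R, GRing.eval x t = p.@[tnth x].
Proof.
elim: t => //=.
- move=> i _; case: (ltnP i n) => [lt_in|le_ni].
    by exists 'X_(Ordinal lt_in) => x; rewrite mevalXU (tnth_nth 0).
  by exists 0 => x; rewrite meval0 nth_default // size_tuple.
- by move=> r _; exists r%:MP => x; rewrite mevalC.
- by move=> k _; exists (1 *+ k) => x; rewrite mevalMn meval1.
- move=> t IHt u IHu /andP[/IHt[p pE] /IHu[q qE]].
  by exists (p + q) => x; rewrite mevalD pE qE.
- by move=> t IHt /IHt[p pE]; exists (- p) => x; rewrite mevalN pE.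
- by move=> t IHt k /IHt[p pE]; exists (p *+ k) => x; rewrite mevalMn pE.
- move=> t IHt u IHu /andP[/IHt[p pE] /IHu[q qE]].
  by exists (p * q) => x; rewrite mevalM pE qE.
- by move=> t IHt k /IHt[p pE]; exists (p ^+ k) => x; rewrite rmorphXn /= pE.
Qed.

Lemma mpoly_rterm n (p : {mpoly R[n]}) :
  exists2 t : GRing.term R, GRing.rterm t &
    forall x : n.-tuple R, GRing.eval x t = p.@[tnth x].
Proof.
rewrite [p]mpolyE; elim: (msupp p : seq _) => [|m s [t rt tE]].
  by exists (GRing.NatConst R 0) => // x; rewrite big_nil meval0.
have [u ru uE] : exists2 u : GRing.term R, GRing.rterm u &
    forall x : n.-tuple R, GRing.eval x u = \prod_(i < n) tnth x i ^+ m i.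
  elim: (index_enum _) => [|i e [u ru uE]].
    by exists (GRing.NatConst R 1) => // x; rewrite big_nil.
  exists (GRing.Mul (GRing.Exp (GRing.Var R i) (m i)) u) => // x.
  by rewrite big_cons /= uE (tnth_nth 0).
exists (GRing.Add (GRing.Mul (GRing.Const p@_m) u) t); first by rewrite /= ru.
by move=> x; rewrite big_cons mevalD mevalZ mevalX /= uE tE.
Qed.

(** The value b is quantified inside the induction because negation exchanges the
    two truth values: a system of sign conditions has no negation of its own, but
    the failure of an atomic condition is again a union of sign conditions. *)
Lemma semialgebraic_qf n (f : ord.formula R) :
  ord.qf_form f -> ord.rformula f ->
  forall b, semialgebraic [set x : n.-tuple R | ord.qf_eval x f == b]%classic.
Proof.
pose S b f := [set x : n.-tuple R | ord.qf_eval x f == b]%classic.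
rewrite -/(S _ _) => qf rf b; elim: f qf rf b => //=.
- by move=> b' _ _ b; exact: semialgebraic_bool.
- move=> t u _ /andP[/(rterm_mpoly n)[p pE] /(rterm_mpoly n)[q qE]] [].
    apply: semialgebraic_ext (semialgebraic_sign (p - q) SignEq) => x /=.
    by rewrite eqb_id mevalB subr_eq0 -pE -qE.
  apply: semialgebraic_ext (semialgebraicU (semialgebraic_sign (p - q) SignGt)
    (semialgebraic_sign (q - p) SignGt)) => x /=.
  rewrite eqbF_neg !mevalB !subr_gt0 -pE -qE neq_lt orbC.
  exact: (rwP orP).
- move=> t u _ /andP[/(rterm_mpoly n)[p pE] /(rterm_mpoly n)[q qE]] [].
    apply: semialgebraic_ext (semialgebraic_sign (q - p) SignGt) => x /=.
    by rewrite eqb_id mevalB subr_gt0 -pE -qE.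
  apply: semialgebraic_ext (semialgebraic_sign (p - q) SignGe) => x /=.
  by rewrite eqbF_neg -leNgt mevalB subr_ge0 -pE -qE.
- move=> t u _ /andP[/(rterm_mpoly n)[p pE] /(rterm_mpoly n)[q qE]] [].
    apply: semialgebraic_ext (semialgebraic_sign (q - p) SignGe) => x /=.
    by rewrite eqb_id mevalB subr_ge0 -pE -qE.
  apply: semialgebraic_ext (semialgebraic_sign (p - q) SignGt) => x /=.
  by rewrite eqbF_neg -ltNge mevalB subr_gt0 -pE -qE.
- move=> f IHf g IHg /andP[qf qg] /andP[rf rg] [].
    apply: semialgebraic_ext (semialgebraicI (IHf qf rf true) (IHg qg rg true)).
    move=> x; rewrite /S /= !eqb_id; exact: (rwP andP).
  apply: semialgebraic_ext (semialgebraicU (IHf qf rf false) (IHg qg rg false)).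
  move=> x; rewrite /S /= !eqbF_neg negb_and; exact: (rwP orP).
- move=> f IHf g IHg /andP[qf qg] /andP[rf rg] [].
    apply: semialgebraic_ext (semialgebraicU (IHf qf rf true) (IHg qg rg true)).
    move=> x; rewrite /S /= !eqb_id; exact: (rwP orP).
  apply: semialgebraic_ext (semialgebraicI (IHf qf rf false) (IHg qg rg false)).
  move=> x; rewrite /S /= !eqbF_neg negb_or; exact: (rwP andP).
- move=> f IHf g IHg /andP[qf qg] /andP[rf rg] [].
    apply: semialgebraic_ext (semialgebraicU (IHf qf rf false) (IHg qg rg true)).
    move=> x; rewrite /S /= eqbF_neg !eqb_id implybE; exact: (rwP orP).
  apply: semialgebraic_ext (semialgebraicI (IHf qf rf true) (IHg qg rg false)).
  move=> x; rewrite /S /= !eqbF_neg eqb_id negb_imply; exact: (rwP andP).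
- move=> f IHf qf rf b.
  apply: semialgebraic_ext (IHf qf rf (~~ b)) => x; rewrite /S /=.
  by case: ord.qf_eval b => [] [].
Qed.

(** Quantifier elimination over real closed fields reduces this to formulas
    without quantifiers. *)
Lemma semialgebraic_formula n (f : ord.formula R) : ord.rformula f ->
  semialgebraic [set x : n.-tuple R | ord.holds x f]%classic.
Proof.
move=> rf; pose wf := @wf_QE_wproj R; pose valid := @valid_QE_wproj R.
have /andP[qg rg] := ord.quantifier_elim_wf wf rf.
apply: semialgebraic_ext (semialgebraic_qf n qg rg true) => x /=.
rewrite eqb_id; apply: iff_sym; apply: rwP.
exact: (ord.quantifier_elim_rformP wf valid).
Qed.

Lemma formula_semialgebraic n (S : set (n.-tuple R)) : semialgebraic S ->
  exists2 f : ord.formula R, ord.rformula f &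
    forall x : n.-tuple R, ord.holds x f <-> S x.
Proof.
case=> F ->; elim: F => [|C F [f rf fP]].
  by exists (ord.Bool false).
have [g rg gP] : exists2 g : ord.formula R, ord.rformula g &
    forall x : n.-tuple R,
      ord.holds x g <-> all (fun c => sign_holds c.2 c.1.@[tnth x]) C.
  elim: C => [|[p s] C [g rg gP]]; first by exists (ord.Bool true).
  have [t rt tE] := mpoly_rterm p.
  pose zero := GRing.NatConst R 0.
  pose h := match s with SignGt => ord.Lt zero t | SignGe => ord.Le zero t
                       | SignEq => ord.Equal t zero end.
  exists (ord.And h g) => [|x].
    by rewrite /= rg andbT /h; case: (s) => /=; rewrite ?rt.
  rewrite /= gP -(rwP andP); suff -> : ord.holds x h <-> sign_holds s p.@[tnth x] by [].
  by rewrite /h; case: (s) => /=; rewrite -tE //; split => /eqP.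
exists (ord.Or g f) => [|x]; first by rewrite /= rg.
by rewrite /= gP fP; exact: (rwP orP).
Qed.

(** Quantifying the variable whose index is the length of the environment appends
    one coordinate, so a block of consecutive quantifiers appends a tuple. *)
Lemma holds_exists_block (f : ord.formula R) k (e : seq R) :
  ord.holds e (foldr ord.Exists f (iota (size e) k)) <->
  exists y : k.-tuple R, ord.holds (e ++ y) f.
Proof.
elim: k e => [|k IH] e /=.
  split; first by exists [tuple]; rewrite cats0.
  by case=> y; rewrite tuple0 cats0.
have snoc z : set_nth 0 e (size e) z = rcons e z.
  by elim: (e) => //= u s ->.
split.
- case=> z; rewrite snoc -(size_rcons e z) => /IH[y hy].
  by exists [tuple of z :: y]; rewrite /= -cat_rcons.
- case=> y; case/tupleP: y => z y hy; exists z.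
  by rewrite snoc -(size_rcons e z); apply/IH; exists y; rewrite cat_rcons.
Qed.

(** The Tarski-Seidenberg theorem: describe S by a formula, bind the last k
    variables, and eliminate the quantifiers. *)
Theorem semialgebraic_projection n k (S : set ((n + k).-tuple R)) :
  semialgebraic S ->
  semialgebraic [set x : n.-tuple R |
    exists y : k.-tuple R, S [tuple of x ++ y]]%classic.
Proof.
case/formula_semialgebraic => f rf fP.
have rg : ord.rformula (foldr ord.Exists f (iota n k)).
  by elim: (iota n k).
apply: semialgebraic_ext (semialgebraic_formula n rg) => x /=.
rewrite -[in iota _ _](size_tuple x); rewrite holds_exists_block.
by split; case=> y /fP; exists y => //; apply/fP.
Qed.

End Projection.

(** * Polynomials with prescribed real roots and conjugate pairs *)

Local Open Scope complex_scope.

Section ConjugatePairPolynomial.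

(** Pairing consecutive entries y, z gives the real quadratic
    (X - y)^2 + z^2 with roots y + iz and y - iz. *)
Fixpoint quadratic_prod (S : comNzRingType) (s : seq S) : {poly S} :=
  if s is y :: z :: s' then
    (('X - y%:P) ^+ 2 + z%:P ^+ 2) * quadratic_prod s'
  else 1.

(** The real polynomial whose roots are coded by the coordinates s: r real roots,
    then conjugate pairs.  It is defined over any commutative ring so that it
    can also be formed with indeterminates as coordinates. *)
Definition conj_pairs_poly (S : comNzRingType) r (s : seq S) : {poly S} :=
  (\prod_(x <- take r s) ('X - x%:P)) * quadratic_prod (drop r s).

Lemma map_conj_pairs_poly (S S' : comNzRingType) (f : {rmorphism S -> S'}) r s :
  map_poly f (conj_pairs_poly r s) = conj_pairs_poly r (map f s).
Proof.
rewrite /conj_pairs_poly rmorphM /= -map_take -map_drop map_prod_XsubC big_map.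
congr (_ * _); move: (drop r s); fix IH 1; case=> [|y [|z s']] /=.
- exact: rmorph1.
- exact: rmorph1.
rewrite rmorphM rmorphD !rmorphXn rmorphB /= map_polyX !map_polyC.
by congr (_ * _); exact: IH.
Qed.

Variable R : realType.

Lemma prod_conj_pairs_list (x : seq R) (yz : seq (R * R)) :
  \prod_(z <- conj_pairs_list x yz) ('X - z%:P) =
  map_poly (real_complex R)
    (conj_pairs_poly (size x) (x ++ flatten [seq [:: p.1; p.2] | p <- yz])).
Proof.
rewrite /conj_pairs_poly take_size_cat // drop_size_cat // rmorphM /=.
rewrite map_prod_XsubC big_cat /= big_map; congr (_ * _).
elim: yz => [|[y z] yz IH] /=; first by rewrite big_nil rmorph1.
rewrite !big_cons {}IH rmorphM /= mulrA; congr (_ * _).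
rewrite rmorphD !rmorphXn rmorphB /= map_polyX !map_polyC /=.
pose w := 'i * z%:C.
have -> : y +i* z = y%:C + w.
  by rewrite /w; simpc.
have -> : y -i* z = y%:C - w.
  by rewrite /w; simpc.
have -> : z%:C%:P ^+ 2 = - w%:P ^+ 2 :> {poly R[i]}.
  by rewrite -!polyC_exp exprMn sqr_i mulN1r polyCN opprK.
rewrite subr_sqr.
by rewrite polyCB polyCD opprB opprD !addrA [_ + w%:P - _]addrAC.
Qed.

(** On U_k having spectrum s is an identity between real polynomials, since the
    embedding of the reals in the complex numbers is injective. *)
Lemma has_spectrum_conj_pairs n k (A : 'M[R]_n) (s : n.-tuple R[i]) :
  U k s -> has_spectrum A s <-> char_poly A = conj_pairs_poly (n - 2 * k) (Phi k s).
Proof.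
case=> x [yz sE]; rewrite /has_spectrum sE prod_conj_pairs_list (PhiE sE).
rewrite size_tuple -map_char_poly.
by split=> [/map_poly_inj|->].
Qed.

End ConjugatePairPolynomial.

(** * The realizable coordinates form a semi-algebraic set *)

Section RealizabilitySemialgebraic.
Variable R : realType.

Definition realized_coordinates n k : set (n.-tuple R) :=
  [set w | exists A : 'M[R]_n, nonneg_mx A /\
             char_poly A = conj_pairs_poly (n - 2 * k) w]%classic.

(** In the space of pairs (coordinates, matrix entries) the defining conditions
    are polynomial: nonnegativity of each entry, and equality of the coefficients
    of two polynomials.  These polynomials are formed once over the ring of
    polynomials in all n + n * n variables, from the generic matrix G and the
    generic coordinates W; specialization commutes with all the constructions.
    Projecting away the matrix entries gives the set in question. *)
Lemma semialgebraic_realized_coordinates n k :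
  semialgebraic (@realized_coordinates n k).
Proof.
pose M := {mpoly R[n + n * n]}.
pose G : 'M[M]_n := \matrix_(i, j) 'X_(rshift n (mxvec_index i j)).
pose W : seq M := [seq 'X_(lshift (n * n) i) | i <- enum 'I_n].
pose P := char_poly G - conj_pairs_poly (n - 2 * k) W.
pose C : seq (M * sign_cond) := [seq (c, SignEq) | c <- P : seq M] ++
  [seq (G ij.1 ij.2, SignGe) | ij <- enum {: 'I_n * 'I_n}].
pose S := [set v : (n + n * n).-tuple R |
  has (all (fun c => sign_holds c.2 c.1.@[tnth v])) [:: C]]%classic.
have Ssem : semialgebraic S by exists [:: C].
apply: semialgebraic_ext (semialgebraic_projection Ssem) => w.
have key (y : (n * n).-tuple R) (A : 'M[R]_n) :
    (forall i j, A i j = tnth y (mxvec_index i j)) ->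
    S [tuple of w ++ y] <->
    nonneg_mx A /\ char_poly A = conj_pairs_poly (n - 2 * k) w.
  move=> Ay; pose ev := meval (tnth [tuple of w ++ y]) : {rmorphism M -> R}.
  have evG i j : ev (G i j) = A i j.
    by rewrite mxE [LHS]mevalXU tnth_rshift Ay.
  have evW : map ev W = w.
    rewrite -map_comp -[RHS]map_tnth_enum; apply: eq_map => i /=.
    by rewrite [LHS]mevalXU tnth_lshift.
  have evP : map_poly ev P = char_poly A - conj_pairs_poly (n - 2 * k) w.
    rewrite rmorphB /= map_char_poly map_conj_pairs_poly evW.
    by congr (char_poly _ - _); apply/matrixP => i j; rewrite mxE evG.
  have -> : S [tuple of w ++ y] <-> all (fun c => sign_holds c.2 (ev c.1)) C.
    by rewrite /S /= orbF.
  rewrite all_cat 2!all_map /=; split.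
  - case/andP=> /allP P0 /allP G0; split=> [i j|].
      by rewrite -evG; have := G0 (i, j); rewrite mem_enum => /(_ isT).
    apply/eqP; rewrite -subr_eq0 -evP; apply/eqP/polyP => i.
    rewrite coef_map coef0; case: (ltnP i (size P)) => [lt_i|le_i].
      by apply/eqP/P0/mem_nth.
    by rewrite nth_default ?[LHS]meval0.
  - case=> A0 /eqP; rewrite -subr_eq0 -evP => /eqP P0; apply/andP; split.
      apply/allP => c /(nthP 0)[i _ <-] /=.
      by rewrite -coef_map P0 coef0.
    by apply/allP => -[i j] _ /=; rewrite evG.
split.
- case=> y; pose A := \matrix_(i, j) tnth y (mxvec_index i j).
  by move=> /(key y A) H; exists A; apply: H => i j; rewrite mxE.
- case=> A HA; exists [tuple mxvec A 0 l | l < n * n]; apply/(key _ A) => //.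
  by move=> i j; rewrite tnth_mktuple mxvecE.
Qed.

End RealizabilitySemialgebraic.

(** * Ordering a conjugation-invariant list *)

Section ConjugatePairOrdering.
Variable R : realType.
Implicit Type s : seq R[i].

(** Conjugation exchanges the entries in the open upper and lower half-planes, so
    the reality condition makes the lower ones a permutation of the conjugates of
    the upper ones.  All the real entries go to x: this is why a real eigenvalue
    leaves strictly less than n / 2 conjugate pairs. *)
Lemma conj_pairs_list_of_reality s : perm_eq s [seq z^* | z <- s] ->
  exists (x : seq R) (yz : seq (R * R)),
    perm_eq (conj_pairs_list x yz) s /\ {subset [pred r | r%:C \in s] <= x}.
Proof.
move=> sconj.
pose re := [pred z : R[i] | complex.Im z == 0].
pose up := [pred z : R[i] | 0 < complex.Im z].
pose lo := [pred z : R[i] | complex.Im z < 0].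
exists [seq complex.Re z | z <- s & re z].
exists [seq (complex.Re z, complex.Im z) | z <- s & up z].
split; last first.
  move=> r; rewrite inE => rs; apply/mapP; exists r%:C => //.
  by rewrite mem_filter rs /= eqxx.
have split3 : perm_eq s ([seq z <- s | re z] ++ [seq z <- s | up z] ++
    [seq z <- s | lo z]).
  rewrite -(perm_filterC re s) perm_cat2l.
  rewrite -(perm_filterC up [seq z <- s | predC re z]).
  have upE : [seq z <- s | predI up (predC re) z] = [seq z <- s | up z].
    by apply: eq_filter => z /=; case: ltgtP.
  have loE : [seq z <- s | predI (predC up) (predC re) z] = [seq z <- s | lo z].
    by apply: eq_filter => z /=; case: ltgtP.
  by rewrite -!filter_predI upE loE.
have lowE : perm_eq [seq z <- s | lo z] [seq z^* | z <- s & up z].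
  rewrite (perm_trans (perm_filter lo sconj)) // filter_map.
  rewrite (@eq_filter _ (preim _ _) up) => [|[a b]]; first exact: perm_refl.
  by rewrite /= oppr_lt0.
rewrite perm_sym (perm_trans split3) // /conj_pairs_list.
have -> : [seq r%:C | r <- [seq complex.Re z | z <- s & re z]] =
    [seq z <- s | re z].
  rewrite -map_comp -[RHS]map_id; apply/eq_in_map => -[a b].
  by rewrite mem_filter => /andP[/eqP /= -> _].
rewrite perm_cat2l (perm_trans (perm_cat (perm_refl _) lowE)) //.
elim: [seq z <- s | up z] => //= -[a b] l IH /=.
rewrite perm_cons; apply: perm_trans (_ : perm_eq _ (a -i* b :: l ++ _)) _.
  by rewrite perm_catC /= perm_cons perm_catC.
by rewrite perm_cons.
Qed.

(** Conjugating the roots of a real polynomial fixes the polynomial, and a monic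
    split polynomial determines the multiset of its roots. *)
Lemma reality_of_real_poly (p : {poly R}) s :
  map_poly (real_complex R) p = \prod_(z <- s) ('X - z%:P) ->
  perm_eq s [seq z^* | z <- s].
Proof.
move=> ps; apply: prod_XsubC_eq.
rewrite big_map -(map_prod_XsubC (conjc : {rmorphism R[i] -> R[i]})) -ps.
rewrite -map_poly_comp; apply: eq_map_poly => r /=.
by rewrite /= oppr0.
Qed.

End ConjugatePairOrdering.

(** * Realizable lists *)

Theorem theorem3p7 (R : realType) (n : nat) (hn : (1 <= n)%N) :
  exists T : 'I_((n + 1) %/ 2) -> set (n.-tuple R),
    (forall k, semialgebraic (T k)) /\
    forall s : n.-tuple R[i],
      realizable s <->
      reality_condition s /\
      exists (k : 'I_((n + 1) %/ 2)) (s' : n.-tuple R[i]),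
        [/\ perm_eq s' s, U k s' & T k (Phi k s')].
Proof.
exists (fun k => @realized_coordinates R n k); split=> [k|s].
  exact: semialgebraic_realized_coordinates.
have spectrum_perm (A : 'M[R]_n) (s1 s2 : n.-tuple R[i]) :
    perm_eq s1 s2 -> has_spectrum A s1 -> has_spectrum A s2.
  by move=> s12; rewrite /has_spectrum => ->; apply: perm_big.
split; last first.
  case=> _ [k [s' [s's Us' [A [A0 /(has_spectrum_conj_pairs A Us') As']]]]].
  by exists A; split=> //; apply: spectrum_perm As'.
case=> A [A0 As].
have sconj : reality_condition s.
  by apply: (@reality_of_real_poly _ (char_poly A)); rewrite map_char_poly.
split=> //.
have [x [yz [perm_s sub_x]]] := conj_pairs_list_of_reality sconj.
have sizeE : (size x + 2 * size yz)%N = n.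
  have /perm_size := perm_s; rewrite size_tuple size_cat size_map => <-.
  congr (_ + _)%N; elim: (yz) => //= p l <-.
  by rewrite mulnS.
have x_gt0 : (0 < size x)%N.
  have [r rootr] : exists r, root (char_poly A) r.
    case: (n) hn A A0 {As} => // n' _ A A0.
    by have [r [rootr _]] := nonneg_perron_resolvent A0; exists r.
  suff : r \in x by case: (x).
  apply: sub_x; rewrite inE /= -root_prod_XsubC -As -map_char_poly.
  by rewrite fmorph_root.
(* The bound m - 1 on k leaves room for one real entry, here a real eigenvalue. *)
have k_lt : (size yz < (n + 1) %/ 2)%N.
  by rewrite leq_divRL // -sizeE mulnC mulnS addnAC leq_add2r addn1.
pose s' : n.-tuple R[i] :=
  Tuple (introT eqP (etrans (perm_size perm_s) (size_tuple s))).
have Us' : U (size yz) s'.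
  have size_x : size x == (n - 2 * size yz)%N by rewrite -sizeE addnK.
  by exists (Tuple size_x), (in_tuple yz).
exists (Ordinal k_lt), s'; split=> //.
exists A; split=> //; apply/(has_spectrum_conj_pairs A Us').
by apply: spectrum_perm As; rewrite perm_sym.
Qed.
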